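(* Let $n\ge1$, $\nu,\mu_e\ge0$ be integers, $\alpha\in\mathbb R$, and let $g_0,\dots,g_\nu$, $q^e_0,\dots,q^e_{\mu_e}$ be real numbers with $\sum_{i=0}^{\mu_e}q^e_i=1$. Consider the learning iteration of the context with $\mathbf Q_u=\mathbf I$ (the $n\times n$ identity), namely $\bar{\mathbf u}_{k+1}=\bar{\mathbf u}_k+\mathbf F\mathbf e_k$, started at $\bar{\mathbf u}_0=\mathbf 0$ (so $\mathbf e_0=\mathbf r$) with an arbitrary reference $\mathbf r\in\mathbb R^{n+2\nu}$, and let $\mathbf A=\mathbf I-\mathbf F\mathbf G^-\mathbf N$. (i) If $\mathbf A$ is stable (all its eigenvalues have modulus less than $1$), then the error converges to the fixed point $\mathbf F\mathbf e_\infty=\mathbf 0$ of the iteration, i.e. $\mathbf F\mathbf e_k\to\mathbf 0$ as $k\to\infty$. (ii) If in addition $$|a_0|+2\sum_{k=1}^{\mu_e+\nu}|a_k|<1,$$ then this convergence is monotonic: for each $p\in\{1,2,\infty\}$ and all $k\ge0$, $\|\mathbf F\mathbf e_{k+1}\|_p\le\|\mathbf F\mathbf e_k\|_p$.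
   Context: Matrices (indices start at 1): - $\mathbf G^-$ is $(n+2\nu)\times(n+2\nu)$ with $\mathbf G^-_{ij}=g_{i-j}$ if $0\le i-j\le\nu$ and $0$ otherwise. - $\mathbf Q_e$ is $(n+2\nu)\times(n+2\nu)$ with $(\mathbf Q_e)_{ij}=q^e_{|i-j|}$ if $|i-j|\le\mu_e$ and $0$ otherwise. - $\mathbf N$ is the $(n+2\nu)\times n$ matrix with $\mathbf N_{ij}=1$ if $i=j+\nu$ and $0$ otherwise. - $\mathbf F=\alpha\mathbf N^T(\mathbf G^-)^T\mathbf Q_e$. Learning iteration: for controls $\bar{\mathbf u}_k\in\mathbb R^n$, the output is $\mathbf y_k=\mathbf G^-\mathbf N\bar{\mathbf u}_k$ and the tracking error is $\mathbf e_k=\mathbf r-\mathbf y_k$. The matrix $\mathbf A=\mathbf I-\alpha\mathbf N^T(\mathbf G^-)^T\mathbf Q_e\mathbf G^-\mathbf N$ is symmetric banded Toeplitz, $\mathbf A_{ij}=a_{|i-j|}$ for $|i-j|\le\mu_e+\nu$ and $0$ otherwise. The numbers $a_0,\dots,a_{\mu_e+\nu}$ are the coefficients of the corresponding noncausal filter $$1-\alpha Q_e(z,z^{-1})G^-(z)G^-(z^{-1})=a_0+\sum_{k=1}^{\mu_e+\nu}a_k(z^k+z^{-k}),$$ where $G^-(z^{-1})=\sum_{i=0}^\nu g_iz^{-i}$ and $Q_e(z,z^{-1})=q^e_0+\sum_{i=1}^{\mu_e}q^e_i(z^i+z^{-i})$. $\|\cdot\|_p$ denotes the usual vector $p$-norm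 on $\mathbb R^n$. *)

(* Defs.v *)
From mathcomp Require Export all_boot all_order all_algebra.
From mathcomp Require Export all_classical all_reals all_analysis.
From mathcomp Require Export complex.
Export numFieldNormedType.Exports.
Set Implicit Arguments.
Unset Strict Implicit.
Unset Printing Implicit Defensive.
Import Order.TTheory GRing.Theory Num.Theory.
Local Open Scope ring_scope.

(* The coefficient families are functions on nat; only g_0, ..., g_nu and
   q_0, ..., q_mu are ever used. Matrix indices start at 0; every formula below
   depends on i - j only, so this shift is harmless. *)
Section Matrices.
Variables (R : realType) (n nu mu : nat) (alpha : R) (g q : nat -> R).

Definition Gmat : 'M[R]_(n + 2 * nu) :=
  \matrix_(i, j) if ((j <= i) && (i - j <= nu))%N then g (i - j)%N else 0.

(* `| _ |%N is the absolute value of an integer, as a natural number. *)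
Definition Qmat : 'M[R]_(n + 2 * nu) :=
  \matrix_(i, j) if (`|(i : int) - (j : int)| <= mu)%N
                 then q `|(i : int) - (j : int)|%N else 0.

Definition Nmat : 'M[R]_(n + 2 * nu, n) :=
  \matrix_(i, j) if (i : nat) == (j + nu)%N then 1 else 0.

Definition Fmat : 'M[R]_(n, n + 2 * nu) :=
  alpha *: (Nmat^T *m Gmat^T *m Qmat).

Definition Amat : 'M[R]_n := 1%:M - Fmat *m Gmat *m Nmat.

Variable r : 'cV[R]_(n + 2 * nu).

Definition tracking_error (u : 'cV[R]_n) : 'cV[R]_(n + 2 * nu) :=
  r - Gmat *m Nmat *m u.

Fixpoint control (k : nat) : 'cV[R]_n :=
  if k is k'.+1 then control k' + Fmat *m tracking_error (control k') else 0.

Definition err (k : nat) : 'cV[R]_(n + 2 * nu) := tracking_error (control k).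

End Matrices.

(* All complex eigenvalues have modulus less than 1. *)
Definition stable (R : realType) (n : nat) (A : 'M[R]_n) : Prop :=
  forall l : R[i], eigenvalue (map_mx (real_complex R) A) l -> `|l| < 1.

Section Filter.
Variables (R : realType) (nu mu : nat) (alpha : R) (g q : nat -> R).

(* Gfilter w stands for \sum_i g_i w^i: the filter G^-(z^-1) is Gfilter z^-1
   and G^-(z) is Gfilter z. *)
Definition Gfilter (w : R[i]) : R[i] :=
  \sum_(0 <= i < nu.+1) real_complex R (g i) * w ^+ i.

Definition Qfilter (z : R[i]) : R[i] :=
  real_complex R (q 0%N) +
  \sum_(1 <= i < mu.+1) real_complex R (q i) * (z ^+ i + z ^- i).

(* The Laurent polynomial identity defining a_0, ..., a_(mu + nu), as an
   identity of functions on the nonzero complex numbers (which determines the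
   coefficients). *)
Definition filter_coefs (a : nat -> R) : Prop :=
  forall z : R[i], z != 0 ->
    1 - real_complex R alpha * Qfilter z * Gfilter z * Gfilter z^-1 =
    real_complex R (a 0%N) +
    \sum_(1 <= k < (mu + nu).+1) real_complex R (a k) * (z ^+ k + z ^- k).

End Filter.

(* The usual vector p-norm for 1 <= p <= +oo; the value at -oo is junk. *)
Definition pnorm (R : realType) (n : nat) (p : \bar R) (x : 'cV[R]_n) : R :=
  match p with
  | EFin s => (\sum_(i < n) `|x i 0| `^ s) `^ s^-1
  | +oo%E => \big[Num.max/0]_(i < n) `|x i 0|
  | -oo%E => 0
  end.

(* Main.v *)
Require Import Defs.
From mathcomp Require Import ring lra zify.
From mathcomp Require Import spectral.
Import Order.TTheory GRing.Theory Num.Theory.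
Local Open Scope classical_set_scope.
Local Open Scope ring_scope.

(** Since e_(k+1) = e_k - G N F e_k, the filtered error x_k = F e_k satisfies
    x_(k+1) = A x_k.  Both claims are therefore about the powers of A.

    For (i), A = I - alpha (G N)^T Q (G N) is real symmetric (Amat_sym), hence
    unitarily diagonalizable over the complex numbers.  When all its eigenvalues
    have modulus less than 1, every coordinate of A^k x_0 is a combination of
    null geometric sequences (symmetric_stable_cvg0).

    For (ii), A is Toeplitz: its (i, j) entry is the coefficient of z^(i - j) in
    the filter 1 - alpha Q(z) G(z) G(z^-1) (Amat_E, filter_Acoef).  The numbers a_k
    represent the same function of z, and a Laurent polynomial is determined by its
    values (laurent_inj), so A_ij = a_|i-j| in the band and 0 outside.  Each row of
    A then has absolute sum at most |a_0| + 2 sum |a_k| < 1 (Amat_row_sum), and so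
    does each column by symmetry.  Schur's test (pnorm_schur) turns these bounds
    into ||A x||_p <= ||x||_p for p = 1, 2, oo. *)

(** * Windows of sums over natural numbers *)

Lemma big_nat_window {V : zmodType} {N} (a m : nat) {f : nat -> V} :
  (a + m <= N)%N ->
  (forall l, (l < N)%N -> ((l < a) || (a + m <= l))%N -> f l = 0) ->
  \sum_(0 <= l < N) f l = \sum_(0 <= s < m) f (a + s)%N.
Proof.
move=> amN f0.
rewrite (@big_cat_nat _ _ _ a) ?(@big_cat_nat _ _ _ (a + m)%N a N) //=; try lia.
rewrite (big_nat_cond _ _ 0%N) big1 ?add0r; last first.
  by move=> l /andP[/andP[_ la] _]; apply: f0; lia.
rewrite [X in _ + X]big_nat_cond [X in _ + X]big1 ?addr0; last first.
  by move=> l /andP[/andP[al lN] _]; apply: f0; lia.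
rewrite -{1}[a]add0n big_addn addKn.
by apply: eq_bigr => l _; rewrite addnC.
Qed.

Lemma ler_sum_nat_window {R : numDomainType} {N} (a m : nat) (f : nat -> R) :
  (a + m <= N)%N -> (forall l, 0 <= f l) ->
  \sum_(0 <= s < m) f (a + s)%N <= \sum_(0 <= l < N) f l.
Proof.
move=> amN f0.
rewrite [leRHS](@big_cat_nat _ _ _ a) ?(@big_cat_nat _ _ _ (a + m)%N a N) //=; try lia.
rewrite -{3}[a]add0n big_addn addKn addrCA.
under eq_bigr do rewrite addnC.
by rewrite lerDl addr_ge0 // sumr_ge0.
Qed.

(** * Laurent polynomials *)

(** The Laurent polynomial with coefficient f d at z^d for |d| <= M.  A sum over
    0 <= i <= 2M of the terms of exponent i - M is used so that shifts of the
    exponent become translations of a window of natural numbers. *)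
Definition laurent {K : fieldType} (M : nat) (f : int -> K) (z : K) : K :=
  \sum_(0 <= i < (2 * M).+1) f (i%:Z - M%:Z) * z ^ (i%:Z - M%:Z).

(** Multiplying by z^k translates the coefficients; the bound on M says that no
    nonzero coefficient is pushed out of the range of exponents. *)
Lemma laurent_shift {K : fieldType} (N M : nat) (k : int) (f : int -> K) (z : K) :
  z != 0 -> (N + `|k| <= M)%N -> (forall d : int, (N < `|d|)%N -> f d = 0) ->
  laurent M (fun d => f (d - k)) z = z ^ k * laurent N f z.
Proof.
move=> z0 kM f0; rewrite /laurent mulr_sumr.
have [a aE] : exists a : nat, a%:Z = M%:Z - N%:Z + k.
  by exists (absz (M%:Z - N%:Z + k)); lia.
rewrite (big_nat_window a (2 * N).+1); first last.
- by move=> l lM la; rewrite f0 ?mul0r //; lia.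
- by lia.
apply: eq_bigr => i _.
have -> : (a + i)%N%:Z - M%:Z - k = i%:Z - N%:Z by lia.
have -> : (a + i)%N%:Z - M%:Z = k + (i%:Z - N%:Z) by lia.
by rewrite expfzDr // mulrCA.
Qed.

Lemma laurent_widen {K : fieldType} (N M : nat) (f : int -> K) (z : K) :
  z != 0 -> (N <= M)%N -> (forall d : int, (N < `|d|)%N -> f d = 0) ->
  laurent M f z = laurent N f z.
Proof.
move=> z0 NM f0; have := laurent_shift N M 0 f z z0.
rewrite expr0z mul1r addn0 => <- //.
by apply: eq_bigr => i _; rewrite subr0.
Qed.

(** The writing b_0 + sum b_k (z^k + z^-k) used for noncausal filters is the
    Laurent polynomial with coefficients b_|d|. *)
Lemma laurent_even {K : fieldType} (M : nat) (b : nat -> K) (z : K) :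
  laurent M (fun d => b `|d|%N) z =
  b 0%N + \sum_(1 <= k < M.+1) b k * (z ^+ k + z ^- k).
Proof.
elim: M => [|M IH].
  by rewrite /laurent muln0 big_nat1 big_geq // subrr expr0z mulr1 addr0.
rewrite big_nat_recr //= addrA -IH /laurent.
rewrite (_ : (2 * M.+1).+1 = (2 * M).+3); last by lia.
rewrite big_nat_recl // big_nat_recr //=.
have -> : (0 : int) - M.+1%:Z = - M.+1%:Z by lia.
have -> : ((2 * M).+2 : int) - M.+1%:Z = M.+1%:Z by lia.
rewrite subn0 /= -exprnP -exprnN addrCA mulrDr [_ * z ^+ _ + _]addrC.
congr (_ + _).
by apply: eq_bigr => i _; congr (b _ * z ^ _); lia.
Qed.

(** After multiplication by z^M the difference of the two sides is a polynomial
    which vanishes at every nonzero z; in characteristic 0 the numbers 1, 2, 3,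
    ... are infinitely many such points, so all its coefficients are 0. *)
Lemma laurent_inj {K : numFieldType} {M : nat} {f h : int -> K} :
  (forall z, z != 0 -> laurent M f z = laurent M h z) ->
  forall d : int, (`|d| <= M)%N -> f d = h d.
Proof.
move=> fh d dM.
pose p := \poly_(i < (2 * M).+1) (f (i%:Z - M%:Z) - h (i%:Z - M%:Z)).
suff p0 : p = 0.
  have [i iE] : exists i : nat, i%:Z = d + M%:Z by exists (absz (d + M%:Z)); lia.
  have := congr1 (fun r : {poly K} => r`_i) p0.
  rewrite /= coef_poly coef0 ifT; last by lia.
  by rewrite (_ : i%:Z - M%:Z = d); [move/eqP; rewrite subr_eq0 => /eqP | lia].
apply: (@roots_geq_poly_eq0 _ p [seq i.+1%:R | i <- iota 0 (size p)]).
- apply/allP => _ /mapP[i _ ->]; set z : K := i.+1%:R.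
  have z0 : z != 0 :> K by rewrite pnatr_eq0.
  rewrite /root horner_poly.
  apply/eqP; transitivity (z ^+ M * (laurent M f z - laurent M h z)); last first.
    by rewrite fh // subrr mulr0.
  rewrite /laurent -sumrB mulr_sumr big_mkord; apply: eq_bigr => j _.
  rewrite -mulrBl mulrCA; congr (_ * _).
  by rewrite !exprnP -expfzDr //; congr (z ^ _); lia.
- by rewrite map_inj_uniq ?iota_uniq // => i j /eqP; rewrite eqr_nat => /eqP[].
- by rewrite size_map size_iota.
Qed.

(** * Powers of a stable symmetric matrix *)

Section SymmetricStable.
Import ComplexField.
Local Open Scope sesquilinear_scope.

Lemma real_complex_normc {R : rcfType} (x : R) : Normc.normc (real_complex R x) = `|x|.
Proof. by rewrite /Normc.normc /= expr0n addr0 sqrtr_sqr. Qed.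

Lemma normc_sum {R : rcfType} {I : finType} (f : I -> R[i]) :
  Normc.normc (\sum_i f i) <= \sum_i Normc.normc (f i).
Proof.
by rewrite -lecR rmorph_sum; exact (ler_norm_sum (index_enum I) f xpredT).
Qed.

Lemma normcX {R : rcfType} (x : R[i]) k : Normc.normc (x ^+ k) = Normc.normc x ^+ k.
Proof.
by elim: k => [|k IH]; rewrite ?expr0 ?Normc.normc1 // !exprS Normc.normcM IH.
Qed.

Lemma cvg_col {R : realType} {n : nat} (u : nat -> 'cV[R]_n) (l : 'cV[R]_n) :
  (forall i, (fun k => u k i 0) @ \oo --> l i 0) -> u @ \oo --> l.
Proof.
move=> ul; apply/cvg_ballP => e e0.
have /filter_forall : forall i, \forall k \near \oo, ball (l i 0) e (u k i 0).
  by move=> i; move/cvg_ballP : (ul i); apply.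
by apply: filterS => k uk; split=> // i j; rewrite ord1; apply: uk.
Qed.

(** By the spectral theorem over R[i], A = P^-1 diag(d) P.  The rows of P are left
    eigenvectors, so stability gives |d_l| < 1, and each coordinate of
    x_k = P^-1 diag(d)^k P x_0 is bounded by a finite sum of geometric sequences
    of ratios |d_l|. *)
Lemma symmetric_stable_cvg0 {R : realType} {n : nat} (A : 'M[R]_n) (x : nat -> 'cV[R]_n) :
  A^T = A -> stable A -> (forall k, x k.+1 = A *m x k) -> x @ \oo --> (0 : 'cV[R]_n).
Proof.
move=> symA stA xS.
pose AC := map_mx (real_complex R) A.
have /orthomx_spectralP : AC \is normalmx.
  have ACE : AC ^t* = AC.
    by apply/matrixP => i j; rewrite !mxE -[in RHS]symA mxE -[RHS]conjc_real.
  by apply/normalmxP; rewrite ACE.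
set P := spectralmx AC; set d := spectral_diag AC => AE.
have Pu : P \in unitmx by exact: spectral_unit.
have PA : P *m AC = diag_mx d *m P by rewrite AE !mulmxA mulmxV // mul1mx.
clearbody P d.
have d_lt1 l : Normc.normc (d 0 l) < 1.
  suff : `|d 0 l| < 1 by rewrite ltcR.
  apply: stA; apply/eigenvalueP; exists (row l P).
    by rewrite -row_mul PA row_mul row_diag_mx -scalemxAl -rowE.
  apply/eqP => /(congr1 (fun v => (v *m invmx P) 0 l)) /eqP.
  by rewrite -row_mul mulmxV // mul0mx !mxE eqxx oner_eq0.
(* c and w are the moduli of the entries of P^-1 and of P x_0. *)
pose c i l := Normc.normc (invmx P i l).
pose w l := Normc.normc ((P *m map_mx (real_complex R) (x 0%N)) l 0).
have xE k : P *m map_mx (real_complex R) (x k) =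
    \col_l (d 0 l ^+ k * (P *m map_mx (real_complex R) (x 0%N)) l 0).
  elim: k => [|k IH].
    by apply/colP => l; rewrite [RHS]mxE expr0 mul1r.
  rewrite xS map_mxM mulmxA PA -mulmxA IH mul_diag_mx.
  by apply/colP => l; rewrite !mxE exprS mulrA.
have x_le i k : `|x k i 0| <= \sum_l c i l * (Normc.normc (d 0 l) ^+ k * w l).
  have -> : `|x k i 0| = Normc.normc ((invmx P *m (P *m map_mx (real_complex R) (x k))) i 0).
    by rewrite mulKmx // mxE real_complex_normc.
  rewrite xE mxE; apply: le_trans (normc_sum _) _.
  by apply: ler_sum => l _; rewrite mxE !Normc.normcM normcX.
apply: cvg_col => i; rewrite mxE; apply/norm_cvg0P.
apply: (@squeeze_cvgr _ _ _ _ (cst 0) (fun k => \sum_l c i l * (Normc.normc (d 0 l) ^+ k * w l))).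
- by apply: nearW => k; rewrite normr_ge0 x_le.
- exact: cvg_cst.
have lim0 : 0 = \sum_(l < n) c i l * (0 * w l).
  by rewrite big1 // => l _; rewrite mul0r mulr0.
rewrite [X in _ --> X]lim0; apply: cvg_big => [|l _]; first exact: add_continuous.
apply: cvgM; first exact: cvg_cst.
apply: cvgM; last exact: cvg_cst.
by apply: cvg_expr; rewrite ger0_norm // -ler0c; exact: normr_ge0 (d 0 l).
Qed.

End SymmetricStable.

(** * Contraction in the vector norms *)

(** Jensen's inequality for the square and weights of total mass at most 1: expand
    the weighted sum of the squares (y_j - T)^2, which is nonnegative, where T is the
    weighted sum of the y_j. *)
Lemma sqr_subavg_le {R : realDomainType} {I : finType} (w y : I -> R) :
  (forall j, 0 <= w j) -> \sum_j w j <= 1 ->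
  (\sum_j w j * y j) ^+ 2 <= \sum_j w j * y j ^+ 2.
Proof.
move=> w0 w1; set T := \sum_j w j * y j.
have : 0 <= \sum_j w j * (y j - T) ^+ 2.
  by apply: sumr_ge0 => j _; rewrite mulr_ge0 ?sqr_ge0.
have -> : \sum_j w j * (y j - T) ^+ 2 =
    \sum_j w j * y j ^+ 2 - 2 * T * T + (\sum_j w j) * T ^+ 2.
  rewrite {3}/T mulr_sumr mulr_suml -sumrB -big_split /=.
  by apply: eq_bigr => j _; ring.
by have := ler_wpM2r (sqr_ge0 T) w1; lra.
Qed.

(** Schur's test.  Each coordinate of A x is at most an average of the |x_j| with
    the weights |A_ij| of a row, which settles p = oo by the row sums; for finite
    p, Jensen's inequality moves the power inside the average, and summing over i
    uses the column sums. *)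
Lemma pnorm_schur {R : realType} {n : nat} (A : 'M[R]_n) (x : 'cV[R]_n) (p : \bar R) :
  (forall i, \sum_j `|A i j| <= 1) -> (forall j, \sum_i `|A i j| <= 1) ->
  p = 1%:E \/ p = 2%:E \/ p = +oo%E -> pnorm p (A *m x) <= pnorm p x.
Proof.
move=> row1 col1.
have Ax_le i : `|(A *m x) i 0| <= \sum_j `|A i j| * `|x j 0|.
  rewrite mxE (le_trans (ler_norm_sum _ _ _)) //.
  by apply: ler_sum => j _; rewrite normrM.
have avg (y : 'I_n -> R) : (forall j, 0 <= y j) ->
    \sum_i \sum_j `|A i j| * y j <= \sum_j y j.
  move=> y0; rewrite exchange_big /=; apply: ler_sum => j _.
  by rewrite -mulr_suml ler_piMl.
case=> [->|[->|->]] /=.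
- apply: ge0_ler_powR; rewrite ?nnegrE ?invr_ge0 ?sumr_ge0 //.
  under eq_bigr do rewrite powRr1 //.
  under [leRHS]eq_bigr do rewrite powRr1 //.
  apply: le_trans (avg _ _) => //; exact: ler_sum.
- apply: ge0_ler_powR; rewrite ?nnegrE ?invr_ge0 ?sumr_ge0 //.
  under eq_bigr do rewrite powR_mulrn //.
  under [leRHS]eq_bigr do rewrite powR_mulrn //.
  apply: le_trans (avg _ _); last by move=> j; exact: sqr_ge0.
  apply: ler_sum => i _.
  apply: le_trans (sqr_subavg_le _ _ _ _) => //.
  by rewrite ler_sqr ?nnegrE ?sumr_ge0 // => j _; exact: mulr_ge0.
- apply/bigmax_leP; split=> [|i _]; first exact: bigmax_ge_id.
  apply: le_trans (Ax_le i) _.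
  set m := \big[Num.max/0]_(j < n) `|x j 0|.
  have m0 : 0 <= m by exact: bigmax_ge_id.
  apply: (@le_trans _ _ (\sum_j `|A i j| * m)).
    by apply: ler_sum => j _; rewrite ler_wpM2l // le_bigmax.
  by rewrite -mulr_suml ler_piMl.
Qed.

(** * The Toeplitz structure of the iteration matrix *)

Section Toeplitz.
Variables (R : realType) (n nu mu : nat) (alpha : R) (g q : nat -> R).

Definition Qcoef (d : int) : R := if (`|d| <= mu)%N then q `|d|%N else 0.

(** The coefficient of z^d in G(z) Q(z) G(z^-1), up to the exchange of s and t. *)
Definition GQGcoef (d : int) : R :=
  \sum_(0 <= s < nu.+1) \sum_(0 <= t < nu.+1) g s * g t * Qcoef (d + s%:Z - t%:Z).

(** Both the entries of A on its d-th diagonal and the coefficient of z^d in the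
    filter 1 - alpha Q(z) G(z) G(z^-1). *)
Definition Acoef (d : int) : R := (d == 0)%:R - alpha * GQGcoef d.

Local Notation GN := (Gmat n nu g *m Nmat R n nu).

Lemma GN_E (l : 'I_(n + 2 * nu)) (j : 'I_n) :
  GN l j = if ((j + nu <= l) && (l - (j + nu) <= nu))%N then g (l - (j + nu))%N else 0.
Proof.
have jlt : (j + nu < n + 2 * nu)%N by have := ltn_ord j; lia.
rewrite mxE (bigD1 (Ordinal jlt)) //= big1 ?addr0 => [|k kj].
  by rewrite !mxE /= eqxx mulr1.
by rewrite [Nmat _ _ _ _ _]mxE ifN ?mulr0.
Qed.

(** N sends the last control sample to row n + nu - 1, and the nu rows below it hold
    the rest of its impulse response g_0, ..., g_nu: no column of G N is truncated.
    This is why A is exactly Toeplitz. *)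
Lemma GN_sum (X : nat -> R) (j : 'I_n) :
  \sum_l GN l j * X l = \sum_(0 <= s < nu.+1) g s * X (j + nu + s)%N.
Proof.
have jn := ltn_ord j.
pose f l := (if ((j + nu <= l) && (l - (j + nu) <= nu))%N
             then g (l - (j + nu))%N else 0) * X l.
transitivity (\sum_(0 <= l < n + 2 * nu) f l).
  by rewrite big_mkord; apply: eq_bigr => l _; rewrite GN_E.
rewrite (big_nat_window (j + nu)%N nu.+1); first last.
- by move=> l lN la; rewrite /f ifF ?mul0r //; lia.
- by lia.
rewrite big_nat [RHS]big_nat; apply: eq_bigr => s s_lt.
by rewrite /f addKn ifT //; lia.
Qed.

Lemma Fmat_GN : Fmat n nu mu alpha g q *m Gmat n nu g *m Nmat R n nu =
  alpha *: (GN^T *m Qmat n nu mu q *m GN).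
Proof. by rewrite /Fmat -!scalemxAl trmx_mul !mulmxA. Qed.

Lemma Amat_E (i j : 'I_n) : Amat n nu mu alpha g q i j = Acoef (i%:Z - j%:Z).
Proof.
rewrite /Amat Fmat_GN !mxE /Acoef; congr (_%:R - alpha * _).
  by rewrite subr_eq0.
pose X (k : nat) := \sum_(0 <= s < nu.+1) g s * Qcoef ((i + nu + s)%N%:Z - k%:Z).
transitivity (\sum_k GN k j * X k).
  apply: eq_bigr => k _; rewrite mulrC; congr (_ * _).
  rewrite mxE /X -(GN_sum (fun l => Qcoef (l%:Z - k%:Z))).
  by apply: eq_bigr => l _; rewrite mxE [Qmat _ _ _ _ _ _]mxE.
rewrite GN_sum /GQGcoef exchange_big /=; apply: eq_bigr => t _.
rewrite /X mulr_sumr; apply: eq_bigr => s _; rewrite mulrA [g t * _]mulrC.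
by congr (_ * _ * Qcoef _); lia.
Qed.

Lemma Amat_sym : (Amat n nu mu alpha g q)^T = Amat n nu mu alpha g q.
Proof.
have Qsym : (Qmat n nu mu q)^T = Qmat n nu mu q.
  by apply/matrixP => i j; rewrite !mxE distnC.
by rewrite /Amat Fmat_GN raddfB /= trmx1 linearZ /= !trmx_mul !trmxK Qsym !mulmxA.
Qed.

Lemma Acoef_out d : (mu + nu < `|d|)%N -> Acoef d = 0.
Proof.
move=> d_gt; rewrite /Acoef /GQGcoef big_nat big1 ?mulr0 ?subr0 => [|s s_lt].
  by rewrite (_ : d == 0 = false) //; lia.
rewrite big_nat big1 // => t t_lt.
by rewrite /Qcoef ifN ?mulr0 //; lia.
Qed.

(** Expand both factors G; each term z^(t - s) translates the coefficients of Q. *)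
Lemma filter_Acoef (z : R[i]) : z != 0 ->
  1 - real_complex R alpha * Qfilter mu q z * Gfilter nu g z * Gfilter nu g z^-1 =
  laurent (mu + nu) (fun d => real_complex R (Acoef d)) z.
Proof.
move=> z0.
have QE : Qfilter mu q z = laurent mu (fun d => real_complex R (Qcoef d)) z.
  rewrite /Qfilter -(laurent_even mu (fun k => real_complex R (q k))).
  rewrite /laurent big_nat [RHS]big_nat; apply: eq_bigr => i i_lt.
  by rewrite /Qcoef ifT //; lia.
have oneE : 1 = laurent (mu + nu) (fun d : int => (d == 0)%:R) z.
  rewrite (@laurent_widen _ 0) // => [|d]; last by case: eqP => [->|].
  by rewrite /laurent muln0 big_nat1 subrr eqxx expr0z mulr1.
have QGG : Qfilter mu q z * Gfilter nu g z * Gfilter nu g z^-1 =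
    laurent (mu + nu) (fun d => real_complex R (GQGcoef d)) z.
  transitivity (\sum_(0 <= s < nu.+1) \sum_(0 <= t < nu.+1)
    real_complex R (g s * g t) *
    laurent (mu + nu) (fun d => real_complex R (Qcoef (d - (t%:Z - s%:Z)))) z).
    rewrite mulrC /Gfilter mulr_suml big_nat [RHS]big_nat; apply: eq_bigr => s s_lt.
    rewrite mulrA mulr_sumr big_nat [RHS]big_nat; apply: eq_bigr => t t_lt.
    rewrite (@laurent_shift _ mu _ _ (fun d => real_complex R (Qcoef d))) //.
    - rewrite -QE expfzDr // -exprnP -exprnN exprVn rmorphM /=; ring.
    - by lia.
    - by move=> d d_gt; rewrite /Qcoef ifN -?ltnNge.
  rewrite /laurent.
  under eq_bigr do under eq_bigr do rewrite mulr_sumr.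
  under eq_bigr do rewrite exchange_big /=.
  rewrite exchange_big /=; apply: eq_bigr => i _.
  rewrite /GQGcoef rmorph_sum mulr_suml; apply: eq_bigr => s _.
  rewrite rmorph_sum mulr_suml; apply: eq_bigr => t _.
  by rewrite [in RHS]rmorphM mulrA; congr (_ * real_complex R (Qcoef _) * _); lia.
rewrite -!mulrA [Qfilter _ _ _ * _]mulrA QGG {1}oneE /laurent mulr_sumr -sumrB.
apply: eq_bigr => i _; rewrite mulrA -mulrBl; congr (_ * _).
by rewrite /Acoef rmorphB rmorphM rmorph_nat.
Qed.

Lemma Acoef_filter_coefs (a : nat -> R) :
  filter_coefs nu mu alpha g q a ->
  forall d : int, Acoef d = if (`|d| <= mu + nu)%N then a `|d|%N else 0.
Proof.
move=> fa d; case: ifPn => [d_le|]; last by rewrite -ltnNge => /Acoef_out.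
apply: (@complexI R).
apply: (@laurent_inj _ (mu + nu) (fun d => real_complex R (Acoef d))
  (fun d => real_complex R (a `|d|%N))) d_le => z z0.
by rewrite -filter_Acoef // fa // -(laurent_even _ (fun k => real_complex R (a k))).
Qed.

(** The absolute values of the entries of row i are the |a_|d||, or 0 outside the
    band, for the d in a window of n consecutive integers; inside a range of exponents large enough to contain this window, the
    other terms are nonnegative, and the whole range sums to the value at z = 1 of
    the Laurent polynomial with coefficients |a_|d||, that is |a_0| + 2 sum |a_k|. *)
Lemma Amat_row_sum (a : nat -> R) (i : 'I_n) :
  filter_coefs nu mu alpha g q a ->
  \sum_j `|Amat n nu mu alpha g q i j| <=
  `|a 0%N| + 2 * \sum_(1 <= k < (mu + nu).+1) `|a k|.
Proof.
move=> fa; set M := (mu + nu)%N; have i_lt := ltn_ord i.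
pose f (d : int) : R := if (`|d| <= M)%N then `|a `|d|%N| else 0.
have f0 d : 0 <= f d by rewrite /f; case: ifP.
have -> : `|a 0%N| + 2 * \sum_(1 <= k < M.+1) `|a k| = laurent M f 1.
  transitivity (laurent M (fun d : int => `|a `|d|%N|) (1 : R)).
    rewrite (laurent_even _ (fun k => `|a k|)) mulr_sumr; congr (_ + _).
    by apply: eq_bigr => k _; rewrite expr1n invr1 mulrC.
  rewrite /laurent big_nat [RHS]big_nat; apply: eq_bigr => k k_lt.
  by rewrite /f ifT //; lia.
rewrite -(@laurent_widen _ M (M + n)) ?oner_eq0 ?leq_addr // => [|d d_gt]; last first.
  by rewrite /f ifN // -ltnNge.
have win := @ler_sum_nat_window R (2 * (M + n)).+1 (M + n - i)%N n
  (fun k => f (k%:Z - (M + n)%N%:Z) * 1 ^ (k%:Z - (M + n)%N%:Z)).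
apply: le_trans (win _ _); last first.
- by move=> l; rewrite exp1rz mulr1 f0.
- by lia.
rewrite big_mkord; apply: ler_sum => j _.
rewrite Amat_E (Acoef_filter_coefs _ fa) exp1rz mulr1 /f.
rewrite (_ : `|i%:Z - j%:Z|%N = `|(M + n - i + j)%N%:Z - (M + n)%N%:Z|%N); last by lia.
by case: ifP; rewrite ?normr0.
Qed.

End Toeplitz.

(** * Convergence of the learning iteration *)

Theorem mainTheorem3 (R : realType) (n nu mu : nat) (alpha : R)
    (g q : nat -> R) (r : 'cV[R]_(n + 2 * nu)) :
  (1 <= n)%N ->
  \sum_(0 <= i < mu.+1) q i = 1 ->
  let F := Fmat n nu mu alpha g q in
  let e := err mu alpha g q r in
  stable (Amat n nu mu alpha g q) ->
  ((fun k : nat => F *m e k) @ \oo --> (0 : 'cV[R]_n)) /\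
  (forall a : nat -> R,
     filter_coefs nu mu alpha g q a ->
     `|a 0%N| + 2 * \sum_(1 <= k < (mu + nu).+1) `|a k| < 1 ->
     forall p : \bar R, p = 1%:E \/ p = 2%:E \/ p = +oo%E ->
     forall k : nat, pnorm p (F *m e k.+1) <= pnorm p (F *m e k)).
Proof.
move=> _ _ F e stA.
have FeS k : F *m e k.+1 = Amat n nu mu alpha g q *m (F *m e k).
  have -> : e k.+1 = e k - Gmat n nu g *m Nmat R n nu *m (F *m e k).
    by rewrite /e /err /= {1}/tracking_error mulmxDr opprD addrA.
  by rewrite mulmxBr /Amat mulmxBl mul1mx !mulmxA.
split; first exact:
  (symmetric_stable_cvg0 _ (fun k => F *m e k) (Amat_sym _ _ _ _ _ _ _) stA FeS).
move=> a fa a_lt1 p pE k; rewrite FeS.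
have row1 i : \sum_j `|Amat n nu mu alpha g q i j| <= 1.
  by apply: le_trans (ltW a_lt1); exact: Amat_row_sum.
apply: pnorm_schur => // j.
by under eq_bigr do rewrite -Amat_sym mxE.
Qed.
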